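(* For every real $x\neq 0$, $$\sum_{k=0}^{\infty}\frac{c_k}{k!}\,x^k = e^{x}\sum_{k=0}^{\infty}\frac{(-x)^k}{k!\,\zeta(2k+2)}=\frac{e^x}{x}\,R(x).$$
   Context: Let $\zeta$ denote the Riemann zeta function. For integers $k\ge 0$ define $$c_k=\sum_{j=0}^k (-1)^j\binom{k}{j}\frac{1}{\zeta(2j+2)}.$$ For real $x$ define the Riesz function (an everywhere convergent power series) $$R(x)=\sum_{k=1}^\infty \frac{(-1)^{k+1}x^k}{(k-1)!\,\zeta(2k)}=x\sum_{k=0}^\infty\frac{(-1)^k x^k}{k!\,\zeta(2k+2)}.$$ *)

(* Defs.v *)
From Stdlib Require Import Reals Factorial.
From Coquelicot Require Import Coquelicot.
Open Scope R_scope.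

(* The Riemann zeta function on the half-line s > 1, where its Dirichlet series
   sum_(n >= 1) n^(-s) converges; for s <= 1 the value is meaningless.  Below
   it is only evaluated at even integers >= 2. *)
Definition zeta (s : R) : R := Series (fun n => / Rpower (INR (S n)) s).

(* [Binomial.C] is the real-valued binomial coefficient (a bare [C] would be
   Coquelicot's complex numbers); [sum_f_R0 f k] is f 0 + ... + f k. *)
Definition c (k : nat) : R :=
  sum_f_R0 (fun j => (-1) ^ j * Binomial.C k j * (1 / zeta (INR (2 * j + 2)))) k.

(* Only used for k >= 1, so the truncated subtraction k - 1 is harmless. *)
Definition Riesz_term (x : R) (k : nat) : R :=
  (-1) ^ (k + 1) * x ^ k / (INR (fact (k - 1)) * zeta (INR (2 * k))).

Definition Riesz (x : R) : R := Series (fun k => Riesz_term x (S k)).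

(* Main.v *)
Require Import Defs.
From Stdlib Require Import Reals Factorial.
From Stdlib Require Import Lra Lia.
From Coquelicot Require Import Coquelicot.
Open Scope R_scope.

(** The coefficients [c k] are the alternating binomial transform of
    a_j = 1 / zeta (2 j + 2).  Since C(k,j) / k! = 1 / (j! (k-j)!), the term
    c_k x^k / k! is the k-th coefficient of the Cauchy product of the series of
    a_j (-x)^j / j! with the exponential series of [x]
    ([binomial_transform_egf]).  Mertens' theorem applies because both factors
    converge absolutely: every zeta value in question is at least 1, the first
    term of its Dirichlet series ([zeta_ge_1]), so the a_j are bounded.  The
    second equality is term by term: each term of the Riesz series is [x] times
    the corresponding term of the series of a_j (-x)^j / j!. *)

(** Comparison with the telescoping series of 1/(n+1) - 1/(n+2), after dropping
    the first term. *)
Lemma ex_series_inv_sqr : ex_series (fun n => / INR (S n) ^ 2).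
Proof.
  apply ex_series_incr_1.
  apply (@ex_series_le R_AbsRing R_CompleteNormedModule _
           (fun n => / INR (S n) - / INR (S (S n)))).
  - intros n.
    change (Rabs (/ INR (S (S n)) ^ 2) <= / INR (S n) - / INR (S (S n))).
    assert (Hn := pos_INR n).
    rewrite Rabs_pos_eq.
    2: { left; apply Rinv_0_lt_compat, pow_lt, lt_0_INR; lia. }
    rewrite !S_INR.
    set (u := INR n + 1).
    assert (Hu : 0 < u) by (unfold u; lra).
    replace (/ u - / (u + 1)) with (/ (u * (u + 1))) by (field; lra).
    apply Rinv_le_contravar; nra.
  - exists 1.
    change (is_lim_seq (sum_n (fun n => / INR (S n) - / INR (S (S n)))) 1).
    apply (is_lim_seq_ext (fun n => 1 - / INR (S (S n)))).
    + intros n; induction n as [|n IH].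
      * rewrite sum_O; simpl; field.
      * rewrite sum_Sn, <- IH.
        change (1 - / INR (S (S (S n))) =
          1 - / INR (S (S n)) + (/ INR (S (S n)) - / INR (S (S (S n))))).
        ring.
    + replace (Finite 1) with (Finite (1 - 0)) by (f_equal; ring).
      apply is_lim_seq_minus'.
      * apply is_lim_seq_const.
      * apply (is_lim_seq_ext (fun n => / INR (n + 2))).
        { intros n; do 2 f_equal; lia. }
        apply (is_lim_seq_incr_n (fun n => / INR n) 2).
        apply (is_lim_seq_inv _ p_infty); [apply is_lim_seq_INR | easy].
Qed.

Lemma zeta_term_pos (s : R) (n : nat) : 0 < / Rpower (INR (S n)) s.
Proof. apply Rinv_0_lt_compat, exp_pos. Qed.

(** Comparison with the case s = 2. *)
Lemma ex_series_zeta (s : R) :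
  2 <= s -> ex_series (fun n => / Rpower (INR (S n)) s).
Proof.
  intros Hs.
  apply (@ex_series_le R_AbsRing R_CompleteNormedModule _
           (fun n => / INR (S n) ^ 2)); [| exact ex_series_inv_sqr].
  intros n.
  change (Rabs (/ Rpower (INR (S n)) s) <= / INR (S n) ^ 2).
  rewrite Rabs_pos_eq by apply Rlt_le, zeta_term_pos.
  assert (Hn : 1 <= INR (S n)) by (rewrite S_INR; generalize (pos_INR n); lra).
  rewrite <- (Rpower_pow 2) by lra.
  apply Rinv_le_contravar; [apply exp_pos |].
  apply Rle_Rpower; [| simpl (INR 2)]; lra.
Qed.

(** The term n = 1 of the Dirichlet series is 1 and all others are positive. *)
Lemma zeta_ge_1 (s : R) : 2 <= s -> 1 <= zeta s.
Proof.
  intros Hs; unfold zeta.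
  rewrite Series_incr_1 by now apply ex_series_zeta.
  replace (/ Rpower (INR 1) s) with 1
    by (unfold Rpower; simpl; rewrite ln_1, Rmult_0_r, exp_0; field).
  assert (H : 0 <= Series (fun n => / Rpower (INR (S (S n))) s)); [| lra].
  (* The zero series is written with terms 0 * 0 so that Series_scal_l sums it. *)
  replace 0 with (Series (fun _ : nat => 0 * 0)) by (rewrite Series_scal_l; ring).
  apply Series_le.
  - intros n; split; [lra |].
    rewrite Rmult_0_l; apply Rlt_le, zeta_term_pos.
  - apply (ex_series_incr_1 (fun n => / Rpower (INR (S n)) s)).
    now apply ex_series_zeta.
Qed.

Lemma is_series_exp (x : R) : is_series (fun k => x ^ k / INR (fact k)) (exp x).
Proof.
  apply (is_series_ext (fun k => scal (pow_n x k) (/ INR (fact k)))).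
  - intros k; now rewrite pow_n_pow.
  - apply is_exp_Reals.
Qed.

Lemma ex_series_abs_exp (x : R) :
  ex_series (fun k => Rabs (x ^ k / INR (fact k))).
Proof.
  apply (ex_series_ext (fun k => Rabs x ^ k / INR (fact k))).
  - intros k; unfold Rdiv.
    now rewrite Rabs_mult, Rabs_inv, <- RPow_abs, (Rabs_pos_eq (INR _)) by apply pos_INR.
  - eexists; apply is_series_exp.
Qed.

(** Domination by the exponential series of [Rabs x]. *)
Lemma ex_series_abs_bounded_egf (a : nat -> R) (M x : R) :
  (forall k, Rabs (a k) <= M) ->
  ex_series (fun k => Rabs (a k * (x ^ k / INR (fact k)))).
Proof.
  intros Ha.
  apply (@ex_series_le R_AbsRing R_CompleteNormedModule _
           (fun k => M * Rabs (x ^ k / INR (fact k)))).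
  - intros k.
    change (Rabs (Rabs (a k * (x ^ k / INR (fact k))))
            <= M * Rabs (x ^ k / INR (fact k))).
    rewrite Rabs_Rabsolu, Rabs_mult.
    apply Rmult_le_compat_r; [apply Rabs_pos | apply Ha].
  - exact (ex_series_scal_l (K := R_AbsRing) M _ (ex_series_abs_exp x)).
Qed.

(** On exponential generating functions the alternating binomial transform is
    [x |-> - x] followed by multiplication by [exp x]: this is the Cauchy
    product, because C(k,j) / k! = 1 / (j! (k-j)!). *)
Lemma binomial_transform_egf (a : nat -> R) (x : R) :
  ex_series (fun k => Rabs (a k * ((- x) ^ k / INR (fact k)))) ->
  is_series
    (fun k => sum_f_R0 (fun j => (-1) ^ j * Binomial.C k j * a j) k
              / INR (fact k) * x ^ k)
    (exp x * Series (fun k => a k * ((- x) ^ k / INR (fact k)))).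
Proof.
  intros Habs.
  rewrite Rmult_comm.
  eapply is_series_ext.
  2: { apply is_series_mult.
       - apply Series_correct, ex_series_Rabs, Habs.
       - apply is_series_exp.
       - exact Habs.
       - apply ex_series_abs_exp. }
  intros k; cbv beta.
  unfold Rdiv at 3; rewrite Rmult_assoc, Rmult_comm, scal_sum.
  apply sum_eq; intros j Hj.
  unfold Binomial.C.
  replace (- x) with (-1 * x) by ring.
  rewrite Rpow_mult_distr.
  replace (x ^ k) with (x ^ j * x ^ (k - j)) by (rewrite <- pow_add; f_equal; lia).
  field; repeat split; apply INR_fact_neq_0.
Qed.

Theorem mainTheorem2 (x : R) (hx : x <> 0) :
  let lhs_term := fun k : nat => c k / INR (fact k) * x ^ k in
  let mid_term := fun k : nat => (- x) ^ k / (INR (fact k) * zeta (INR (2 * k + 2))) in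
  (ex_series lhs_term /\
   ex_series mid_term /\
   ex_series (fun k : nat => Riesz_term x (S k))) /\
  Series lhs_term = exp x * Series mid_term /\
  exp x * Series mid_term = exp x / x * Riesz x.
Proof.
  intros lhs_term mid_term.
  assert (Hz : forall k, 1 <= zeta (INR (2 * k + 2))).
  { intros k; apply zeta_ge_1.
    rewrite plus_INR; simpl (INR 2); generalize (pos_INR (2 * k)); lra. }
  pose (a := fun k => 1 / zeta (INR (2 * k + 2))).
  assert (Ha : forall k, Rabs (a k) <= 1).
  { intros k; unfold a, Rdiv; rewrite Rmult_1_l; specialize (Hz k).
    rewrite Rabs_pos_eq by (left; apply Rinv_0_lt_compat; lra).
    rewrite <- Rinv_1; apply Rinv_le_contravar; lra. }
  assert (Habs := ex_series_abs_bounded_egf a 1 (- x) Ha).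
  assert (Emid : forall k, a k * ((- x) ^ k / INR (fact k)) = mid_term k).
  { intros k; unfold a, mid_term; specialize (Hz k); field.
    split; first [lra | apply INR_fact_neq_0]. }
  assert (Hmid : ex_series mid_term).
  { apply (ex_series_ext _ _ Emid), ex_series_Rabs, Habs. }
  assert (Hlhs : is_series lhs_term (exp x * Series mid_term)).
  { rewrite <- (Series_ext _ _ Emid); exact (binomial_transform_egf a x Habs). }
  assert (ERiesz : forall k, x * mid_term k = Riesz_term x (S k)).
  { intros k; unfold mid_term, Riesz_term.
    replace (2 * S k)%nat with (2 * k + 2)%nat by lia.
    replace (S k - 1)%nat with k by lia.
    replace (S k + 1)%nat with (S (S k)) by lia.
    replace (- x) with (-1 * x) by ring.
    rewrite Rpow_mult_distr; simpl pow.
    specialize (Hz k); field.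
    split; first [lra | apply INR_fact_neq_0]. }
  repeat split.
  - eexists; exact Hlhs.
  - exact Hmid.
  - apply (ex_series_ext _ _ ERiesz).
    exact (ex_series_scal_l (K := R_AbsRing) x _ Hmid).
  - now apply is_series_unique.
  - unfold Riesz; rewrite <- (Series_ext _ _ ERiesz), Series_scal_l.
    now field.
Qed.
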